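(* Let $K$ be a Hausdorff abelian pro-Lie group which has an open almost connected subgroup $H$. Then for every cardinal $\kappa$, every surjective continuous homomorphism $f: \mathbb{Z}^\kappa \to K$ is an open mapping.
   Context: All topological groups are assumed Hausdorff and abelian. For a topological group $K$, $K_0$ denotes the connected component of the identity. A topological group $K$ is called almost connected if the quotient group $K/K_0$ is compact. A topological group is called a pro-Lie group if it is (topologically isomorphic to) a closed subgroup of a product of finite-dimensional Lie groups. The group $\mathbb{Z}^\kappa$ carries the product (Tychonoff) topology, where $\mathbb{Z}$ is the discrete group of integers. *)

(* Defs.v *)
From HB Require Import structures.
From mathcomp Require Import all_boot all_order all_algebra.
From mathcomp Require Import ring_quotient.
From mathcomp Require Import all_classical all_reals all_analysis.
Import numFieldNormedType.Exports.

Set Implicit Arguments.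
Unset Strict Implicit.
Unset Printing Implicit Defensive.

Import Order.TTheory GRing.Theory Num.Theory.
Import Quotient.

Local Open Scope classical_set_scope.
Local Open Scope ring_scope.

Record subgroup_type (G : zmodType) (H : zmodClosed G) : Type :=
  Subgroup { subgroup_val : G; _ : subgroup_val \in H }.

Section SubgroupZmodule.
Variables (G : zmodType) (H : zmodClosed G).
HB.instance Definition _ := [isSub for @subgroup_val G H].
HB.instance Definition _ := [Choice of subgroup_type H by <:].
HB.instance Definition _ := [SubChoice_isSubZmodule of subgroup_type H by <:].
End SubgroupZmodule.

Section SubgroupTopology.
Variables (G : topologicalZmodType) (H : zmodClosed G).

HB.instance Definition _ := Topological.copy (subgroup_type H)
  (initial_topology (val : subgroup_type H -> G)).

Lemma subgroup_sub_continuous :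
  continuous (fun p : subgroup_type H * subgroup_type H => p.1 - p.2).
Proof.
have cval : continuous (val : subgroup_type H -> G) by exact: initial_continuous.
apply/continuousP => _ [A oA <-].
have /continuousP : continuous
    (fun p : subgroup_type H * subgroup_type H => val p.1 - val p.2).
  move=> p.
  apply: (@continuous_comp _ _ _ (fun q : subgroup_type H * subgroup_type H =>
    (val q.1, val q.2)) (fun q : G * G => q.1 - q.2)); last exact: sub_continuous.
  apply: cvg_pair => /=.
    by apply: continuous_comp; [exact: cvg_fst|exact: cval].
  by apply: continuous_comp; [exact: cvg_snd|exact: cval].
by move=> /(_ _ oA); congr open; apply/funext => p /=; rewrite raddfB.
Qed.

HB.instance Definition _ := PreTopologicalNmodule_isTopologicalZmodule.Build
  (subgroup_type H) subgroup_sub_continuous.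
End SubgroupTopology.

Section ProductZmodule.
Variables (I : Type) (L : I -> zmodType).
Implicit Types f g h : prod_topology L.

Let zero : prod_topology L := fun=> 0.
Let opp f : prod_topology L := fun i => - f i.
Let add f g : prod_topology L := fun i => f i + g i.

Let addA : associative add.
Proof. by move=> f g h; apply: functional_extensionality_dep => i; exact: addrA. Qed.
Let addC : commutative add.
Proof. by move=> f g; apply: functional_extensionality_dep => i; exact: addrC. Qed.
Let add0 : left_id zero add.
Proof. by move=> f; apply: functional_extensionality_dep => i; exact: add0r. Qed.
Let addN : left_inverse zero opp add.
Proof. by move=> f; apply: functional_extensionality_dep => i; exact: addNr. Qed.

HB.instance Definition _ :=
  GRing.isZmodule.Build (prod_topology L) addA addC add0 addN.
End ProductZmodule.

Section ProductTopologicalZmodule.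
Variables (I : Type) (L : I -> topologicalZmodType).

Lemma prod_sub_continuous :
  continuous (fun p : prod_topology L * prod_topology L => p.1 - p.2).
Proof.
move=> p; apply/cvg_sup => i.
have cproj : continuous (fun f : prod_topology L => f i) by exact: (@proj_continuous {classic I} L i).
have /continuousP cd : continuous
    (fun q : prod_topology L * prod_topology L => q.1 i - q.2 i).
  move=> q.
  apply: (@continuous_comp _ _ _ (fun q : prod_topology L * prod_topology L =>
    (q.1 i, q.2 i)) (fun q : L i * L i => q.1 - q.2)); last exact: sub_continuous.
  apply: cvg_pair => /=.
    by apply: (@continuous_comp _ _ _ fst (fun f : prod_topology L => f i));
      [exact: cvg_fst|exact: cproj].
  by apply: (@continuous_comp _ _ _ snd (fun f : prod_topology L => f i));
    [exact: cvg_snd|exact: cproj].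
move=> B [_ [[A oA <-] Ap] AB].
apply: (filterS AB).
by apply: open_nbhs_nbhs; split; [exact: (cd _ oA)|exact: Ap].
Qed.

HB.instance Definition _ := PreTopologicalNmodule_isTopologicalZmodule.Build
  (prod_topology L) prod_sub_continuous.
End ProductTopologicalZmodule.

HB.instance Definition _ := GRing.Zmodule.copy (discrete_topology int) int.

Lemma discrete_int_sub_continuous :
  continuous (fun p : discrete_topology int * discrete_topology int =>
    p.1 - p.2).
Proof.
move=> [x y] A /nbhs_singleton Axy.
exists ([set x], [set y]); first by split; exact: discrete_set1.
by move=> [_ _] [/= -> ->].
Qed.

HB.instance Definition _ := PreTopologicalNmodule_isTopologicalZmodule.Build
  (discrete_topology int) discrete_int_sub_continuous.

Definition integer_power (kappa : Type) : Type :=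
  prod_topology (fun _ : kappa => discrete_topology int).

HB.instance Definition _ (kappa : Type) :=
  TopologicalZmodule.on (integer_power kappa).

Definition identity_component (G : topologicalZmodType) : {pred G} :=
  [pred x | x \in connected_component [set: G] 0].
Arguments identity_component : clear implicits.

Section IdentityComponent.
Variable G : topologicalZmodType.

Lemma identity_component_zmod_closed : zmod_closed (identity_component G).
Proof.
split=> [|x y]; first by rewrite !inE; exact: connected_component_refl.
rewrite !inE => x0 y0.
suff xy : connected_component [set: G] x (x - y).
  exact: connected_component_trans x0 xy.
exists ((fun z => x - z) @` connected_component [set: G] 0); last by exists y.
split=> //.
  by exists 0; [exact: connected_component_refl|rewrite subr0].
apply: connected_continuous_connected; first exact: component_connected.
apply: continuous_subspaceT => z.
apply: (@continuous_comp _ _ _ (fun z => (x, z)) (fun p : G * G => p.1 - p.2));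
  last exact: sub_continuous.
by apply: cvg_pair => /=; [exact: cvg_cst|exact: cvg_id].
Qed.

HB.instance Definition _ := GRing.isZmodClosed.Build G (identity_component G)
  identity_component_zmod_closed.
End IdentityComponent.

Definition almost_connected (G : topologicalZmodType) : Prop :=
  compact [set: quotient_topology {quot identity_component G}].

(* Intended for open [U]: existence and continuity on [U] of all iterated
   directional derivatives, through total differentiability at each order. *)
Fixpoint continuously_differentiable (R : realType) (V W : normedModType R)
    (k : nat) (U : set V) (f : V -> W) : Prop :=
  if k is k'.+1 then
    (forall x, U x -> differentiable f x) /\
    (forall v, continuously_differentiable k' U (fun x => 'D_v f x))
  else {in U, continuous f}.

Definition smooth (R : realType) (V W : normedModType R)
    (U : set V) (f : V -> W) : Prop :=
  forall k, continuously_differentiable k U f.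

(* Outside [chart_dom] and [chart_cod] the two maps carry no information. *)
Record chart (R : realType) (n : nat) (G : topologicalType) := Chart {
  chart_dom : set G;
  chart_cod : set 'rV[R]_n;
  chart_map :> G -> 'rV[R]_n;
  chart_inv : 'rV[R]_n -> G;
  chart_dom_open : open chart_dom;
  chart_cod_open : open chart_cod;
  chart_mapP : forall x, chart_dom x -> chart_cod (chart_map x);
  chart_invP : forall u, chart_cod u -> chart_dom (chart_inv u);
  chart_mapK : {in chart_dom, cancel chart_map chart_inv};
  chart_invK : {in chart_cod, cancel chart_inv chart_map};
  chart_map_continuous : {in chart_dom, continuous chart_map};
  chart_inv_continuous : {in chart_cod, continuous chart_inv}
}.

Definition smooth_atlas (R : realType) (n : nat) (G : topologicalType)
    (A : set (chart R n G)) : Prop :=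
  (forall x, exists2 a, A a & chart_dom a x) /\
  (forall a b, A a -> A b ->
    smooth [set u | chart_cod a u /\ chart_dom b (chart_inv a u)]
           (fun u => b (chart_inv a u))).

Definition smooth_add (R : realType) (n : nat) (G : topologicalZmodType)
    (A : set (chart R n G)) : Prop :=
  forall a b c, A a -> A b -> A c ->
    smooth [set p : 'rV[R]_n * 'rV[R]_n | [/\ chart_cod a p.1, chart_cod b p.2 &
              chart_dom c (chart_inv a p.1 + chart_inv b p.2)]]
           (fun p => c (chart_inv a p.1 + chart_inv b p.2)).

Definition smooth_opp (R : realType) (n : nat) (G : topologicalZmodType)
    (A : set (chart R n G)) : Prop :=
  forall a b, A a -> A b ->
    smooth [set u | chart_cod a u /\ chart_dom b (- chart_inv a u)]
           (fun u => b (- chart_inv a u)).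

(* No countability is required of the manifold, so every discrete group is a
   (zero-dimensional) Lie group. By homogeneity all charts of a Lie group have
   the same dimension [n]. *)
Definition lie_group (R : realType) (G : topologicalZmodType) : Prop :=
  hausdorff_space G /\
  exists (n : nat) (A : set (chart R n G)),
    [/\ smooth_atlas A, smooth_add A & smooth_opp A].

Definition topologically_isomorphic (G H : topologicalZmodType) : Prop :=
  exists (f : {additive G -> H}) (g : {additive H -> G}),
    [/\ cancel f g, cancel g f, continuous f & continuous g].

Definition pro_lie (R : realType) (G : topologicalZmodType) : Prop :=
  exists (I : Type) (L : I -> topologicalZmodType)
         (P : zmodClosed (prod_topology L)),
    [/\ forall i, lie_group R (L i),
        closed [set x | x \in P] &
        topologically_isomorphic G (subgroup_type P)].

(* Main.v *)
Require Import Defs.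
From HB Require Import structures.
From mathcomp Require Import all_boot all_order all_algebra.
From mathcomp Require Import all_classical all_reals all_analysis.
From mathcomp Require Import ring_quotient lra.
Import Order.TTheory GRing.Theory Num.Theory numFieldNormedType.Exports.

Set Implicit Arguments.
Unset Strict Implicit.
Unset Printing Implicit Defensive.

Local Open Scope classical_set_scope.
Local Open Scope ring_scope.

(** The mechanism has two halves.

    Compactness. A continuous homomorphism from a power of the integers to a
    Lie group kills an open subgroup of finite corank, because the open
    subgroups form a basis at 0 while a Lie group has no small subgroups
    ([lie_hom_cylinder]).  Its image is therefore finitely generated, hence
    countable, and a connected countable subset of a manifold is a point
    ([countable_connected_chart]).  Applied to the coordinates of the pro-Lie
    group K, which is the image of such a power, this makes the identity
    component of K trivial ([pro_lie_image_totally_disconnected]).  The open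
    almost connected subgroup H is then compact.

    Openness. Let U be a basic open subgroup, cut out by the vanishing of
    finitely many coordinates and so small that C = f(U) lies in H.  The
    closure C' of C is compact.  For every n > 0, division with remainder
    writes U as n U + B with B compact, so f(B) + n C' is compact and contains
    C; hence C' = C + n C' for all n.  The group of all values of f modulo C is
    finitely generated and contains no nonzero divisible subgroup, so C' = C
    ([image_cylinder_closed]).  Thus C is closed, it has countably many cosets,
    and Baire's theorem in the compact open set H gives it an interior point.
    A subgroup with an interior point is open. *)

(** * Topological abelian groups *)

Lemma addf_continuous (T : topologicalType) (G : topologicalZmodType)
    (f g : T -> G) :
  continuous f -> continuous g -> continuous (fun x => f x + g x).
Proof.
move=> cf cg x; apply: (@continuous_comp _ _ _ (fun x => (f x, g x))
  (fun p : G * G => p.1 + p.2)); last exact: add_continuous.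
by apply: cvg_pair; [exact: cf|exact: cg].
Qed.

Lemma nbhs_translate (G : topologicalZmodType) (a x : G) (A : set G) :
  nbhs (a + x) A -> nbhs x [set y | A (a + y)].
Proof.
by apply: (@addf_continuous _ G (fun=> a) id) => y;
  [exact: cvg_cst|exact: cvg_id].
Qed.

Lemma mulrn_continuous (G : topologicalZmodType) (n : nat) :
  continuous (fun x : G => x *+ n).
Proof.
elim: n => [|n IHn]; first by move=> x; exact: cvg_cst.
rewrite (_ : (fun x => _) = (fun x : G => x + x *+ n)).
  by apply: addf_continuous => // x; exact: cvg_id.
by apply/funext => y; rewrite mulrS.
Qed.

(** * Cylinders in powers of the integers *)

(** The basic open subgroups of the power.  The index type carries no decidable
    equality of its own, so membership in [s] goes through [{classic kappa}]. *)
Definition cylinder (kappa : Type) (s : seq {classic kappa}) :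
    set (integer_power kappa) :=
  [set x | forall i, i \in s -> x i = 0].

Section Cylinders.
Variable kappa : Type.
Implicit Types (s t : seq {classic kappa}) (x y z : integer_power kappa).

(** The sets containing a translate [x + cylinder s] form a filter, and this
    filter converges coordinatewise to [x], hence converges in the product
    topology, which is a supremum of topologies. *)
Lemma nbhs_integer_power x (A : set (integer_power kappa)) :
  nbhs x A -> exists s, forall z, cylinder s z -> A (x + z).
Proof.
pose F : set_system (integer_power kappa) := [set B : set (integer_power kappa) |
  exists s, forall z, cylinder s z -> B (x + z)].
suff Fx : F --> x by move=> /Fx.
have FF : Filter F.
  split.
  - by exists [::].
  - move=> B C [s sB] [t tC]; exists (s ++ t) => z stz; split.
      by apply: sB => i si; apply: stz; rewrite mem_cat si.
    by apply: tC => i ti; apply: stz; rewrite mem_cat ti orbT.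
  - by move=> B C BC [s sB]; exists s => z /sB /BC.
apply/cvg_sup => i B [_ [[C oC <-] Cx] CB].
exists [:: i] => z zi; apply: CB => /=.
rewrite /= in Cx; suff -> : (x + z) i = x i by [].
have -> : (x + z) i = x i + z i by [].
by rewrite zi ?inE// addr0.
Qed.

Lemma cylinderB s x y : cylinder s x -> cylinder s y -> cylinder s (x - y).
Proof.
move=> sx sy i si; have -> : (x - y) i = x i - y i by [].
by rewrite sx// sy// subr0.
Qed.

Lemma cylinderN s x : cylinder s x -> cylinder s (- x).
Proof. by move=> sx; rewrite -sub0r; apply: cylinderB. Qed.

Lemma cylinderD s x y : cylinder s x -> cylinder s y -> cylinder s (x + y).
Proof. by move=> sx sy; rewrite -[y]opprK; apply/cylinderB/cylinderN. Qed.

Lemma cylinder_mulrn s x n : cylinder s x -> cylinder s (x *+ n).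
Proof.
move=> sx; elim: n => [|n IHn]; first by rewrite mulr0n.
by rewrite mulrS; exact: cylinderD.
Qed.

Lemma integer_power_mulrnE x n i : (x *+ n) i = x i *+ n.
Proof.
elim: n => [|n IHn]; first by rewrite !mulr0n.
by rewrite !mulrS -IHn.
Qed.

Definition finite_support s (t : seq int) : integer_power kappa :=
  fun i : {classic kappa} => if i \in s then nth 0 t (index i s) else 0.

Lemma cylinder_sub_finite_support s x :
  cylinder s (x - finite_support s [seq x i | i <- s]).
Proof.
move=> i si; rewrite [LHS](_ : _ = x i - (if i \in s
  then nth 0 [seq x i | i <- s] (index i s) else 0))//.
by rewrite si (nth_map i) ?index_mem// nth_index// subrr.
Qed.

(** A coset of [cylinder s] is determined by the values at the finitely many
    points of [s], and there are countably many such lists of integers. *)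
Lemma cylinder_cosets s :
  exists a : nat -> integer_power kappa, forall x, exists n, cylinder s (x - a n).
Proof.
exists (fun n => finite_support s (odflt [::] (unpickle n))) => x.
exists (pickle [seq (x i : int) | i <- s]); rewrite pickleK.
exact: cylinder_sub_finite_support.
Qed.

Lemma integer_power_mulrzE x (m : int) i : (x *~ m) i = x i *~ m.
Proof. by case: m => n; [|congr (- _)]; exact: integer_power_mulrnE. Qed.

Lemma cylinder_mulrz s x (m : int) : cylinder s x -> cylinder s (x *~ m).
Proof.
by case: m => n sx; [|apply: cylinderN]; exact: cylinder_mulrn.
Qed.

(** A system of remainders modulo [n] in [cylinder s], compact because each
    coordinate takes finitely many values. *)
Definition digit_box s (n : nat) : set (integer_power kappa) :=
  [set z | forall i : {classic kappa},
    if i \in s then z i = 0 else exists2 k : nat, (k < n)%N & z i = k%:Z].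

Lemma digit_box_cylinder s n : digit_box s n `<=` cylinder s.
Proof. by move=> z + i si => /(_ i); rewrite si. Qed.

Lemma cylinder_division s n x : (0 < n)%N -> cylinder s x ->
  exists y z, [/\ cylinder s y, digit_box s n z & x = y *+ n + z].
Proof.
move=> n0 sx.
exists (fun i => divz (x i) n%:Z), (fun i => modz (x i) n%:Z); split.
- by move=> i si; rewrite sx// div0z.
- move=> i; case: ifPn => [si|_]; first by rewrite sx// mod0z.
  have m0 : 0 <= modz (x i) n%:Z by rewrite modz_ge0// gt_eqF.
  exists `|modz (x i) n%:Z|%N; last by rewrite gez0_abs.
  by rewrite -ltz_nat gez0_abs// ltz_pmod.
- apply: functional_extensionality_dep => i.
  rewrite -[RHS]/((_ *+ n) i + _) integer_power_mulrnE.
  by rewrite [LHS](divz_eq (x i) n%:Z) -mulrzz -pmulrn.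
Qed.

Lemma digit_box_compact s n : compact (digit_box s n).
Proof.
apply: (@tychonoff {classic kappa} (fun=> discrete_topology int) (fun i =>
  [set m | if i \in s then m = 0
           else exists2 k : nat, (k < n)%N & m = k%:Z])).
move=> i; apply: finite_compact.
apply: (@sub_finite_set _ _ ((fun k : nat => k%:Z) @` `I_n.+1)).
  move=> m /=; case: ifP => _ [k]; first by exists 0.
  by move=> kn ->; exists k => //=; exact: leqW.
exact/finite_image/finite_II.
Qed.
End Cylinders.

(** * Images of cylinders in compact groups *)

Lemma mulrz_sg_absz (a m : int) : a *~ (Num.sg a * m) = m *+ `|a|%N.
Proof. by rewrite pmulrn !mulrzz abszE normrEsg mulrCA mulrA mulrC mulrA. Qed.

Lemma int_eq_mulrn_absS (a m : int) : a = m *+ `|a|%N.+1 -> a = 0.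
Proof.
move=> am; apply: contrapT => /eqP a0.
have m0 : m != 0 by apply: contra_neq a0 => m0; rewrite am m0 mul0rn.
have : (`|a| = `|m| * `|a|.+1)%N 
  by move/(congr1 absz): am; rewrite pmulrn mulrzz abszM.
move: m0; rewrite -absz_gt0; case: `|m|%N => // k _ /eqP.
by rewrite mulSn eqn_leq => /andP[_]; rewrite addSn ltnNge leq_addr.
Qed.

Section CompactImage.
Variables (K : topologicalZmodType) (kappa : Type).
Variable f : {additive integer_power kappa -> K}.
Hypotheses (K_hausdorff : hausdorff_space K) (f_continuous : continuous f).

(** With [C] the image of the cylinder and [B] a digit box, [n C' + f(B)] is
    compact for the closure [C'] of [C], hence closed, and it contains [C]; so it
    contains [C']. Modulo [C] every element of [C'] is therefore divisible
    by [n] within [C']. *)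
Lemma closure_image_division s n : compact (closure (f @` cylinder s)) ->
    (0 < n)%N -> forall x, closure (f @` cylinder s) x ->
  exists y z,
    [/\ closure (f @` cylinder s) y, cylinder s z & x = y *+ n + f z].
Proof.
set C := f @` cylinder s => cC n0.
pose D := (fun p : K * integer_power kappa => p.1 *+ n + f p.2) @`
  (closure C `*` digit_box s n).
have cD : compact D.
  apply: continuous_compact; last first.
    exact: compact_setX cC (@digit_box_compact _ s n).
  apply: continuous_subspaceT => p.
  apply: addf_continuous => {p} p.
    apply: (@continuous_comp _ _ _ fst (fun y : K => y *+ n)).
      exact: cvg_fst.
    exact: mulrn_continuous.
  by apply: (@continuous_comp _ _ _ snd f); [exact: cvg_snd|exact: f_continuous].
have CD : C `<=` D.
  move=> _ [x sx <-]; have [y [z [sy bz ->]]] := cylinder_division n0 sx.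
  exists (f y, z); last by rewrite raddfD raddfMn.
  by split => //=; apply: subset_closure; exists y.
move=> x /(closure_subset CD).
rewrite -(closure_id D).1; last exact: compact_closed.
move=> [[y z] [/= Cy /digit_box_cylinder sz] <-].
by exists y, z.
Qed.

(** The quotient of the range of [f] by the image [C] of the cylinder is
    generated by the coordinates in [s], and the closure of [C] is divisible
    modulo [C].  A finitely generated abelian group has no nonzero divisible
    subgroup: adding the coordinates of [s] to [t] one at a time, the closure
    stays inside the image of [cylinder t], since at each stage the question is
    about a divisible subgroup of a cyclic group. *)
Lemma image_cylinder_closed s (H : set K) : compact H -> H `<=` range f ->
  f @` cylinder s `<=` H -> closed (f @` cylinder s).
Proof.
move=> cH Hf sH; set C := f @` cylinder s.
have CH : closure C `<=` H.
  rewrite [X in _ `<=` X](closure_id H).1; last exact: compact_closed.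
  exact: closure_subset.
have cC : compact (closure C).
  exact: subclosed_compact (@closed_closure _ C) cH CH.
suff claim t : {subset t <= s} -> closure C `<=` f @` cylinder t.
  by apply: claim.
elim: t => [_ x /CH /Hf [u _ <-]|i t IHt its]; first by exists u.
have si : i \in s by apply: its; rewrite mem_head.
have {}IHt : closure C `<=` f @` cylinder t.
  by apply: IHt => j tj; apply: its; rewrite inE tj orbT.
have st z : cylinder s z -> cylinder t z.
  by move=> sz j tj; apply: sz; apply: its; rewrite inE tj orbT.
move=> x Cx; have [u tu ux] := IHt x Cx.
have approx n : (0 < n)%N ->
    exists w (m : int), [/\ cylinder t w, f w = 0 & u i = w i + m *+ n].
  move=> n0; have [y [z [Cy sz xE]]] := closure_image_division cC n0 Cx.
  have [v tv vy] := IHt y Cy.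
  exists (u - (v *+ n + z)), (v i); split.
  - apply: cylinderB => //; apply: cylinderD; first exact: cylinder_mulrn.
    exact: st.
  - by rewrite raddfB raddfD raddfMn ux xE vy subrr.
  - rewrite -[(u - _) i]/(u i - ((v *+ n) i + z i)) integer_power_mulrnE.
    by rewrite sz// addr0 subrK.
(* It suffices to correct the coordinate [u i] by an element of the kernel. *)
suff [w [tw w0 wi]] : exists w, [/\ cylinder t w, f w = 0 & w i = u i].
  exists (u - w); last by rewrite raddfB w0 subr0.
  move=> j; rewrite inE => /predU1P[->|tj]; last exact: (cylinderB tu tw).
  by rewrite -[LHS]/(u i - w i) wi subrr.
have [[w0 [tw0 fw0 w0i]]|ker0] := pselect (exists w0,
    [/\ cylinder t w0, f w0 = 0 & w0 i <> 0]).
- (* The image of [cylinder t] modulo that of [cylinder (i :: t)] is cyclic, and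
     here [w0 i] annihilates it; divisibility by this number then already puts
     [u i] among the [i]-th coordinates of the kernel. *)
  have [|w [m [tw fw ->]]] := approx `|w0 i : int|%N.
    by rewrite absz_gt0; apply/eqP.
  exists (w + w0 *~ (Num.sg (w0 i : int) * m)); split.
  + by apply: cylinderD => //; exact: cylinder_mulrz.
  + by rewrite raddfD raddfMz fw fw0 mul0rz addr0.
  + rewrite -[LHS]/(w i + (w0 *~ _) i) integer_power_mulrzE; congr (_ + _).
    exact: mulrz_sg_absz.
- (* This cyclic quotient is now infinite, so [u i] is an integer divisible by every
     positive integer; a divisor larger than its absolute value forces 0. *)
  have [//|w [m [tw fw ui]]] := approx `|u i : int|.+1%N.
  have wi0 : w i = 0 by apply: contrapT => wi; apply: ker0; exists w.
  exists w; split => //.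
  by rewrite wi0; apply/esym/(@int_eq_mulrn_absS _ m); rewrite [LHS]ui wi0 add0r.
Qed.
End CompactImage.

(** * Baire category in a compact open set *)

(** If no [F n] had an interior point, regularity would give a decreasing
    sequence of nonempty open sets inside [H] whose closures successively avoid
    [F 0], [F 1] and so on; by compactness it has a cluster point in [H], which
    would escape the cover. *)
Lemma compact_baire (T : topologicalType) (H : set T) (F : nat -> set T) :
    hausdorff_space T -> compact H -> open H -> H !=set0 ->
    (forall n, closed (F n)) -> H `<=` \bigcup_n F n ->
  exists n (x : T), nbhs x (F n).
Proof.
move=> hT cH oH [x0 Hx0] cF HF; apply: contrapT => noint.
pose good (U : set T) := [/\ open U, U !=set0 & U `<=` H].
have shrink n U : good U ->
    exists V, [/\ good V, closure V `<=` U & closure V `&` F n = set0].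
  move=> [oU [x Ux] UH].
  have [y Uy Fy] : exists2 y, U y & ~ F n y.
    apply: contrapT => UF; apply: noint; exists n, x.
    apply: filterS (open_nbhs_nbhs (conj oU Ux)) => y Uy.
    by apply: contrapT => Fy; apply: UF; exists y.
  have nUF : nbhs y (U `&` ~` F n).
    apply: filterI; first exact: open_nbhs_nbhs.
    by apply: open_nbhs_nbhs; split => //; exact: closed_openC.
  have nH : nbhs y H by apply: open_nbhs_nbhs; split => //; exact: UH.
  have [B nB BUF] := compact_regular hT cH nH nUF.
  have BoB : closure B° `<=` U `&` ~` F n.
    exact: subset_trans (closure_subset (@interior_subset _ B)) BUF.
  exists B°; split.
  - split; [exact: open_interior|by exists y|].
    by move=> z /subset_closure /BoB [/UH].
  - by move=> z /BoB [].
  - by rewrite -subset0 => z [/BoB []].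
have /choice[next nextP] : forall nU : nat * set T, exists V, good nU.2 ->
    [/\ good V, closure V `<=` nU.2 & closure V `&` F nU.1 = set0].
  move=> [n U]; have [gU|ngU] := pselect (good U); last by exists set0.
  by have [V VP] := shrink n U gU; exists V.
pose O := fix O n := if n is n'.+1 then next (n', O n') else H.
have gO n : good (O n).
  elim: n => [|n IHn]; first by split => //; exists x0.
  by have [] := nextP (n, O n) IHn.
have Odec m n : (m <= n)%N -> O n `<=` O m.
  move=> /subnK <-; elim: (n - m)%N => [//|k IHk].
  have [_ h _] := nextP ((k + m)%N, O (k + m)%N) (gO _).
  by rewrite addSn => x /subset_closure /h /IHk.
pose G : set_system T := [set A | exists n, O n `<=` A].
have FG : ProperFilter G.
  split; first by move=> [n]; have [_ [x Ox] _] := gO n => /(_ x Ox).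
  split.
  - by exists 0%N.
  - move=> A B [m mA] [n nB]; exists (maxn m n) => x Ox; split.
      by apply: mA; apply: Odec Ox; exact: leq_maxl.
    by apply: nB; apply: Odec Ox; exact: leq_maxr.
  - by move=> A B AB [n nA]; exists n; exact: subset_trans AB.
have [p [Hp Gp]] : H `&` cluster G !=set0 by apply: cH; exists 0%N.
have [n _ Fp] := HF _ Hp.
have [_ _ h] := nextP (n, O n) (gO n).
suff : (closure (O n.+1) `&` F n) p by rewrite h.
split => // A nA; apply: Gp => //.
by exists n.+1.
Qed.

(** * Lie groups have no small subgroups *)

(** In a chart sending 0 to [u], let [F] be the addition.  Its differential at
    [(u, u)] is the sum of the two arguments, as [F] is the identity in each
    variable when the other one is [u].  Doubling is thus multiplication by 2
    around [u] up to an error of half the displacement, so it expands by the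
    factor 3/2 at least, and no point other than 0 has all its iterated doubles
    close to 0. *)
Lemma lie_no_small_subgroups (R : realType) (L : topologicalZmodType) :
  lie_group R L -> exists2 V : set L, nbhs 0 V &
    forall x : L, (forall k, V (x *+ 2 ^ k)) -> x = 0.
Proof.
move=> [hL [n [A [[Acover _] Aadd _]]]].
have [a Aa a0] := Acover 0.
set u := a 0.
have cu : chart_cod a u by exact: chart_mapP.
have uK : chart_inv a u = 0 by rewrite chart_mapK ?inE.
pose F (p : 'rV[R]_n * 'rV[R]_n) := a (chart_inv a p.1 + chart_inv a p.2).
have Fuu : F (u, u) = u by rewrite /F /= uK addr0.
have [dF _] := Aadd a a a Aa Aa Aa 1%N.
have {}dF : differentiable F (u, u).
  by apply: dF; split => //=; rewrite uK addr0.
have Fnear h : chart_cod a (u + h) -> F (u + h, u) = u + h.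
  by move=> ch; rewrite /F /= uK addr0 chart_invK ?inE.
have FnearC h : chart_cod a (u + h) -> F (u, u + h) = u + h.
  by move=> ch; rewrite /F /= uK add0r chart_invK ?inE.
pose D : 'rV[R]_n * 'rV[R]_n -> 'rV[R]_n := 'd F (u, u).
have Feps (e : R) : 0 < e -> \forall h \near (0 : 'rV[R]_n * 'rV[R]_n),
    `|F ((u, u) + h) - u - D h| <= e * `|h|.
  move=> e0; have := diff_locally dF.
  move/eqaddoP => /(_ e e0); apply: filterS => h /=.
  rewrite [X in `|X| <= _](_ : _ = F ((u, u) + h) - u - D h) //=.
  by rewrite !fctE /= Fuu opprD addrA [h + _]addrC.
have [r r0 /= rP] : exists2 r : R, 0 < r & forall h, `|h| < r ->
    chart_cod a (u + h) /\ `|F (u + h, u + h) - u - (h + h)| <= 2^-1 * `|h|.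
  have : \forall h \near (0 : 'rV[R]_n), chart_cod a (u + h) /\
      `|F (u + h, u + h) - u - (h + h)| <= 2^-1 * `|h|.
    (* The estimate is used along the two axes and the diagonal, whence three
       errors of one sixth. *)
    have nearcomp (g : 'rV[R]_n -> 'rV[R]_n * 'rV[R]_n) :
        g 0 = 0 -> continuous g ->
        \forall h \near (0 : 'rV[R]_n),
          `|F ((u, u) + g h) - u - D (g h)| <= 6^-1 * `|g h|.
      move=> g0 cg; have e0 : 0 < 6^-1 :> R by rewrite invr_gt0.
      by have := Feps _ e0; rewrite -g0 => /(cg 0).
    have nearcod : \forall h \near (0 : 'rV[R]_n), chart_cod a (u + h).
      apply: (@nbhs_translate _ u); rewrite addr0.
      by apply: open_nbhs_nbhs; split => //; exact: chart_cod_open.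
    have cid : continuous (id : 'rV[R]_n -> 'rV[R]_n).
      by move=> x; exact: cvg_id.
    have cst0 : continuous (fun _ : 'rV[R]_n => 0 : 'rV[R]_n).
      exact: cst_continuous.
    have cpair (g k : 'rV[R]_n -> 'rV[R]_n) : continuous g -> continuous k ->
        continuous (fun h => (g h, k h)).
      by move=> cg ck x; apply: (cvg_pair (cg x) (ck x)).
    have n1 := nearcomp (fun h => (h, 0)) erefl (cpair _ _ cid cst0).
    have n2 := nearcomp (fun h => (0, h)) erefl (cpair _ _ cst0 cid).
    have n3 := nearcomp (fun h => (h, h)) erefl (cpair _ _ cid cid).
    near=> h.
    have ch : chart_cod a (u + h) by near: h.
    have h1 : `|h - D (h, 0)| <= 6^-1 * `|h|.
      suff : `|F ((u, u) + (h, 0)) - u - D (h, 0)|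
          <= 6^-1 * `|(h, 0 : 'rV[R]_n)|.
        rewrite [X in F X](_ : _ = (u + h, u)); last first.
          by congr pair; rewrite addr0.
        by rewrite Fnear// [u + h]addrC addrK prod_normE /= normr0 max_l.
      by near: h.
    have h2 : `|h - D (0, h)| <= 6^-1 * `|h|.
      suff : `|F ((u, u) + (0, h)) - u - D (0, h)|
          <= 6^-1 * `|(0 : 'rV[R]_n, h)|.
        rewrite [X in F X](_ : _ = (u, u + h)); last first.
          by congr pair; rewrite addr0.
        by rewrite FnearC// [u + h]addrC addrK prod_normE /= normr0 max_r.
      by near: h.
    have h3 : `|F (u + h, u + h) - u - D (h, h)| <= 6^-1 * `|h|.
      suff : `|F ((u, u) + (h, h)) - u - D (h, h)| <= 6^-1 * `|(h, h)|.
        by rewrite prod_normE /= max_l.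
      by near: h.
    have Dhh : D (h, h) = D (h, 0) + D (0, h).
      rewrite /D -linearD; congr ('d _ _ _).
      by congr pair => /=; rewrite ?addr0 ?add0r.
    split => //.
    rewrite (_ : F _ - u - _ = (F (u + h, u + h) - u - D (h, h))
        - (h - D (h, 0)) - (h - D (0, h))); last first.
      rewrite Dhh !opprB -[RHS]addrA [X in _ = _ + X]addrACA.
      by rewrite [RHS]addrA subrK opprD.
    apply: (le_trans (ler_normB _ _)).
    apply: (@le_trans _ _ (6^-1 * `|h| + 6^-1 * `|h| + 6^-1 * `|h|)).
      by apply: lerD => //; apply: (le_trans (ler_normB _ _)); exact: lerD.
    by lra.
  move=> /nbhs_normP[r /= r0 rP]; exists r => // h hr.
  by apply: rP; rewrite /= sub0r normrN.
pose V := [set y | chart_dom a y /\ `|a y - u| < r].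
exists V.
  apply: filterI.
    by apply: open_nbhs_nbhs; split => //; exact: chart_dom_open.
  have : nbhs u [set v : 'rV[R]_n | `|v - u| < r].
    by apply: filterS (nbhsx_ballx u r r0) => v; rewrite -ball_normE /= distrC.
  by apply: (@chart_map_continuous _ _ _ a); rewrite inE.
move=> x Vx; pose h k := a (x *+ 2 ^ k) - u.
have inv_h k : chart_inv a (u + h k) = x *+ 2 ^ k.
  by have [dk _] := Vx k; rewrite addrC subrK chart_mapK ?inE.
have grow k : 3 / 2 * `|h k| <= `|h k.+1|.
  have [_ /rP[_]] := Vx k.
  rewrite /F /= !inv_h -mulr2n -mulrnA -expnSr -/(h k.+1) => hk.
  have := ler_normB (h k.+1) (h k.+1 - (h k + h k)).
  rewrite subKr -[X in `|X| <= _]mulr2n normrMn.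
  by lra.
(* A linear lower bound is enough to leave the ball of radius [r]. *)
have lin k : (1 + k%:R / 2) * `|h 0%N| <= `|h k|.
  elim: k => [|k IHk]; first by lra.
  apply: le_trans (grow k); rewrite -natr1.
  have : 0 <= k%:R / 2 * `|h 0%N| by rewrite !mulr_ge0.
  by lra.
have h0 : h 0%N = 0.
  apply: contrapT => /eqP; rewrite -normr_gt0 => h0.
  have [_] := Vx (Num.bound (r / `|h 0%N| * 2)); apply/negP; rewrite -leNgt.
  apply: le_trans (lin _).
  rewrite -ler_pdivrMr//.
  have : r / `|h 0%N| * 2 < (Num.bound (r / `|h 0%N| * 2))%:R.
    by apply: archi_boundP; rewrite !mulr_ge0// ?invr_ge0// ltW.
  by lra.
by have := inv_h 0%N; rewrite h0 addr0 uK expn0 mulr1n.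
Unshelve. all: by end_near. Qed.

(** * Countable connected sets in manifolds *)

Lemma itv_uncountable (R : realType) (m : R) (S : set R) :
  0 < m -> countable S -> exists r, [/\ 0 < r, r < m & ~ S r].
Proof.
move=> m0 cS; apply: contrapT => nor.
have sub : `]0, m[%classic `<=` S.
  move=> r; rewrite /= in_itv /= => /andP[r0 rm].
  by apply: contrapT => Sr; apply: nor; exists r.
have := countable_lebesgue_measure0 (sub_countable (subset_card_le sub) cS).
rewrite lebesgue_measure_itv /= lte_fin m0 oppr0 adde0 => -[] m0'.
by rewrite m0' ltxx in m0.
Qed.

(** Some small radius [rho] is not the distance in the chart from [p] to any
    point of [E].  The open and the closed chart balls of that radius then cut
    the same subset out of [E], which is open and closed in [E]; the closed ball
    is closed in [T] because it is compact there. *)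
Lemma countable_connected_chart (R : realType) (n : nat) (T : topologicalType)
    (a : chart R n T) (p : T) (E : set T) :
  hausdorff_space T -> chart_dom a p -> connected E -> countable E -> E p ->
  E `<=` [set p].
Proof.
move=> hT dp cE ctE Ep y Ey; apply: contrapT => yp.
set u := a p.
have cu : chart_cod a u by exact: chart_mapP.
have [r /= r0 rP] : exists2 r : R, 0 < r &
    forall v, `|v - u| < r -> chart_cod a v.
  have : nbhs u (chart_cod a).
    by apply: open_nbhs_nbhs; split => //; exact: chart_cod_open.
  move=> /nbhs_normP[r /= r0 rP]; exists r => // v vr.
  by apply: rP; rewrite /= distrC.
have [m m0 [mr my]] : exists2 m : R, 0 < m &
    m <= r /\ (chart_dom a y -> m <= `|a y - u|).
  have [dy|ndy] := pselect (chart_dom a y); last by exists r.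
  exists (Num.min r `|a y - u|); last by rewrite !ge_min !lexx orbT.
  rewrite lt_min r0 normr_gt0 subr_eq0 /=; apply/eqP => ayu; apply: yp.
  by rewrite /= -(@chart_mapK _ _ _ a y) ?inE// ayu chart_mapK ?inE.
have [rho [rho0 rhom rhoE]] : exists rho, [/\ 0 < rho, rho < m &
    ~ ((fun e => `|a e - u|) @` E) rho].
  by apply: itv_uncountable => //; exact: sub_countable (card_image_le _ _) ctE.
have rhocod v : `|v - u| <= rho -> chart_cod a v.
  by move=> vr; apply: rP; apply: le_lt_trans vr (lt_le_trans rhom mr).
pose O := [set x | chart_dom a x /\ `|a x - u| < rho].
pose B := [set v : 'rV[R]_n | `|v - u| <= rho].
have oO : open O.
  rewrite openE => x [dx xr]; apply: filterI.
    by apply: open_nbhs_nbhs; split => //; exact: chart_dom_open.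
  have : nbhs (a x) [set v : 'rV[R]_n | `|v - u| < rho].
    apply: open_nbhs_nbhs; split => //.
    rewrite (_ : [set _ | _] = ball u rho); first exact: ball_open.
    by rewrite -ball_normE; apply/seteqP; split => v /=; rewrite distrC.
  by apply: (@chart_map_continuous _ _ _ a); rewrite inE.
have cB : closed (chart_inv a @` B).
  apply: compact_closed => //; apply: continuous_compact.
    apply: continuous_in_subspaceT => v; rewrite inE => /rhocod cv.
    by apply: chart_inv_continuous; rewrite inE.
  apply: bounded_closed_compact.
    exists (`|u| + rho); split; first exact: num_real.
    move=> M uM v vB; apply: le_trans (ltW uM).
    by rewrite -[v](subrK u) addrC (le_trans (ler_normD _ _))// lerD2l.
  rewrite (_ : B = closed_ball u rho); first exact: closed_ball_closed.
  rewrite closed_ballE//; apply/seteqP.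
  by split => v; rewrite /B /closed_ball_ /= distrC.
have EOB : E `&` O = E `&` (chart_inv a @` B).
  apply/seteqP; split=> x [Ex].
    move=> [dx xr]; split => //; exists (a x); first exact: ltW.
    by rewrite chart_mapK ?inE.
  move=> [v vB vx]; split => //; have cv := rhocod v vB.
  have dx : chart_dom a x by rewrite -vx; exact: chart_invP.
  have ax : a x = v by rewrite -vx chart_invK ?inE.
  split => //; rewrite lt_neqAle ax vB andbT; apply/eqP => vr.
  by apply: rhoE; exists x => //; rewrite ax.
have EE : E `&` O = E.
  apply: cE; [|by exists O|by exists (chart_inv a @` B)].
  by exists p; split => //; split => //; rewrite subrr normr0.
have [_ [dy]] : (E `&` O) y by rewrite EE.
by apply/negP; rewrite -leNgt; apply: le_trans (ltW rhom) (my dy).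
Qed.

(** * From pro-Lie groups to compact open subgroups *)

Section LieHomomorphisms.
Variables (R : realType) (L : topologicalZmodType) (kappa : Type).
Variable h : {additive integer_power kappa -> L}.
Hypotheses (L_lie : lie_group R L) (h_continuous : continuous h).

(** The image of a cylinder is a subgroup, and it lies in a prescribed
    neighbourhood of 0 when the cylinder is small enough. *)
Lemma lie_hom_cylinder : exists s, forall x, cylinder s x -> h x = 0.
Proof.
have [V V0 noV] := lie_no_small_subgroups L_lie.
have : nbhs (0 : integer_power kappa) (h @^-1` V).
  by apply: h_continuous; rewrite raddf0.
move=> /nbhs_integer_power[s sV]; exists s => x sx; apply: noV => k.
rewrite -raddfMn.
by have := sV _ (cylinder_mulrn (2 ^ k) sx); rewrite add0r.
Qed.

Lemma lie_hom_countable : countable (range h).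
Proof.
have [s hs] := lie_hom_cylinder; have [a aP] := cylinder_cosets s.
apply: (@sub_countable _ _ _ [set: nat]); last exact: countableP.
apply: card_le_trans (card_image_le (h \o a) _).
apply: subset_card_le => _ [x _ <-].
have [n xan] := aP x; exists n => //=.
by apply/esym/eqP; rewrite -subr_eq0 -raddfB; apply/eqP/hs.
Qed.

End LieHomomorphisms.

Lemma connected_countable_lie (R : realType) (L : topologicalZmodType)
    (E : set L) :
  lie_group R L -> connected E -> countable E -> E 0 -> E `<=` [set 0].
Proof.
move=> [hL [n [A [[Acover _] _ _]]]] cE ctE E0.
have [a _ a0] := Acover 0.
exact: (countable_connected_chart hL a0).
Qed.

Section Coordinate.
Variables (I : Type) (L : I -> topologicalZmodType) (i : I).
(** A named evaluation map, so that compositions with it are recognized as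
    additive. *)
Definition coordinate (x : prod_topology L) : L i := x i.
Lemma coordinate_zmod_morphism : zmod_morphism coordinate. Proof. by []. Qed.
HB.instance Definition _ :=
  GRing.isZmodMorphism.Build _ _ coordinate coordinate_zmod_morphism.
Lemma coordinate_continuous : continuous coordinate.
Proof. exact: (@proj_continuous {classic I} L i). Qed.
End Coordinate.

(** The coordinates of the identity component of [K] in an embedding into a
    product of Lie groups are connected, and countable because [f] is onto. *)
Lemma pro_lie_image_totally_disconnected (R : realType)
    (K : topologicalZmodType) (kappa : Type)
    (f : {additive integer_power kappa -> K}) :
  pro_lie R K -> continuous f -> range f = [set: K] ->
  connected_component [set: K] 0 `<=` [set 0].
Proof.
move=> [I [L [P [L_lie _ [phi [psi [phiK _ cphi _]]]]]]] cf sf x Cx.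
apply: (can_inj phiK); rewrite raddf0; apply: val_inj.
apply: functional_extensionality_dep => i.
pose p : {additive K -> L i} := (@coordinate I L i \o val \o phi)%FUN.
have cp : continuous p.
  move=> y; apply: continuous_comp; first exact: cphi.
  apply: continuous_comp; last exact: coordinate_continuous.
  exact: initial_continuous.
suff : (p @` connected_component [set: K] 0) `<=` [set 0].
  by apply; exists x.
apply: (connected_countable_lie (L_lie i)).
- apply: connected_continuous_connected; first exact: component_connected.
  exact: continuous_subspaceT.
- have cpf : continuous (p \o f)%FUN.
    by move=> y; apply: continuous_comp; [exact: cf|exact: cp].
  apply: sub_countable (lie_hom_countable (L_lie i) cpf).
  apply: subset_card_le => _ [y _ <-].
  have : range f y by rewrite sf.
  by move=> [z _ <-]; exists z.
- by exists 0; [exact: connected_component_refl|rewrite raddf0].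
Qed.

(** The identity component of [H] lies in that of [K], so the compact quotient
    of [H] by it is [H] itself. *)
Lemma almost_connected_compact (K : topologicalZmodType) (H : zmodClosed K) :
  connected_component [set: K] 0 `<=` [set 0] ->
  almost_connected (subgroup_type H) -> compact [set x | x \in H].
Proof.
move=> K0 cQ; set S := subgroup_type H in cQ *.
pose Q := Quotient.quot (identity_component S).
have cval : continuous (val : S -> K) by exact: initial_continuous.
have S0 (x : S) : x \in identity_component S -> x = 0.
  rewrite inE => Cx; apply: val_inj; rewrite raddf0; apply: K0.
  exists (val @` connected_component [set: S] 0); last by exists x.
  split => //; first by exists 0; [exact: connected_component_refl|rewrite raddf0].
  apply: connected_continuous_connected; first exact: component_connected.
  exact: continuous_subspaceT.
have piK (x : S) : repr (\pi_Q x)%qT = x.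
  apply/eqP; rewrite -subr_eq0; apply/eqP/S0.
  have /eqP := reprK (\pi_Q x)%qT.
  by rewrite -Quotient.idealrBE.
have crepr : continuous (repr : quotient_topology Q -> S).
  apply/quotient_continuous.
  rewrite (_ : _ \o _ = id); first by move=> x; exact: cvg_id.
  by apply/funext => x /=; exact: piK.
rewrite (_ : [set x | x \in H] =
    (val \o (repr : quotient_topology Q -> S)) @` setT).
  apply: continuous_compact => //; apply: continuous_subspaceT => q.
  by apply: continuous_comp; [exact: crepr|exact: cval].
apply/seteqP; split => x /=.
  by move=> xH; exists (\pi_Q (Subgroup xH))%qT => //=; rewrite piK.
by move=> [q _ <-]; exact: valP.
Qed.

(** * The open mapping theorem *)

(** The image of a small cylinder is closed, and [H] is covered by countably
    many of its translates, so one of them, hence the image itself, is a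
    neighbourhood of one of its points. *)
Lemma open_mapping_compact_open_subgroup (K : topologicalZmodType)
    (H : zmodClosed K) (kappa : Type)
    (f : {additive integer_power kappa -> K}) :
  hausdorff_space K -> compact [set x | x \in H] -> open [set x | x \in H] ->
  continuous f -> range f = [set: K] ->
  forall U : set (integer_power kappa), open U -> open (f @` U).
Proof.
move=> hK cH oH cf sf U oU; rewrite openE => _ [u Uu <-].
have nH : nbhs (0 : K) [set x | x \in H].
  by apply: open_nbhs_nbhs; split => //=; exact: rpred0.
have [s0 s0U] := nbhs_integer_power (open_nbhs_nbhs (conj oU Uu)).
have [s1 s1H] : exists s, forall z, cylinder s z -> f z \in H.
  have /nbhs_integer_power[s sH] : nbhs (0 : integer_power kappa)
      (f @^-1` [set x | x \in H]) by apply: cf; rewrite raddf0.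
  by exists s => z /sH /=; rewrite add0r.
pose s := s0 ++ s1; set C := f @` cylinder s.
have cC : closed C.
  apply: (image_cylinder_closed hK cf cH); first by rewrite sf.
  move=> _ [z sz <-]; apply: s1H => i i1; apply: sz.
  by rewrite mem_cat i1 orbT.
have CB x y : C x -> C y -> C (x - y).
  move=> [v sv <-] [w sw <-]; exists (v - w); last by rewrite raddfB.
  exact: cylinderB.
have [a aP] := cylinder_cosets s.
pose F n := [set y | C (y - f (a n))].
have cF n : closed (F n).
  apply: (@closed_comp _ _ (fun y => y - f (a n)) C) => // y _.
  apply: (@addf_continuous _ _ id (fun=> - f (a n))) => z.
    exact: cvg_id.
  exact: cvg_cst.
have HF : [set x | x \in H] `<=` \bigcup_n F n.
  move=> y _; have : range f y by rewrite sf.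
  move=> [x _ <-]; have [n xan] := aP x; exists n => //.
  by exists (x - a n) => //; rewrite raddfB.
have [n [x nFx]] := compact_baire hK cH oH (ex_intro _ 0 (rpred0 H)) cF HF.
have nC : nbhs (0 : K) C.
  have Fx : F n x := nbhs_singleton nFx.
  have : nbhs (0 : K) [set y | F n (x + y)] by apply: nbhs_translate; rewrite addr0.
  apply: filterS => y Fxy; have := CB _ _ Fxy Fx.
  by rewrite opprB addrA subrK addrAC subrr add0r.
have : nbhs (f u) [set y | C (- f u + y)] by apply: nbhs_translate; rewrite addNr.
apply: filterS => y [z sz zE].
exists (u + z); last by rewrite raddfD zE addNKr.
by apply: s0U => i i0; apply: sz; rewrite mem_cat i0.
Qed.

Theorem theorem6 (R : realType) (K : topologicalZmodType) (H : zmodClosed K)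
    (K_hausdorff : hausdorff_space K) (K_pro_lie : pro_lie R K)
    (H_open : open [set x | x \in H])
    (H_almost_connected : almost_connected (subgroup_type H))
    (kappa : Type) (f : {additive integer_power kappa -> K})
    (f_continuous : continuous f) (f_surjective : range f = [set: K]) :
  forall U : set (integer_power kappa), open U -> open (f @` U).
Proof.
apply: (@open_mapping_compact_open_subgroup K H) => //.
apply: almost_connected_compact => //.
exact: pro_lie_image_totally_disconnected K_pro_lie f_continuous f_surjective.
Qed.
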